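(* Work over the semifield $\mathbb{R}_{\max,+}$. Let $\bm{A}=(a_{ij})$ be an $n\times n$ matrix all of whose columns $\bm{a}_1,\ldots,\bm{a}_n$ are regular. Define the scalar $$\Delta=\|\bm{A}\bm{A}^{-}\|.$$ Consider the problem of finding regular vectors $\bm{x}=(x_i)$ with $n$ components that maximize $\|\bm{y}\|\,\|\bm{y}^{-}\|$ subject to $\bm{A}\bm{x}=\bm{y}$. Then the maximum is equal to $\Delta$, and a regular vector $\bm{x}$ attains it if and only if there exist a scalar $\alpha>\mathbb{0}$, an index $k\in\{1,\ldots,n\}$ at which $\|\bm{a}_{i}\|\,\|\bm{a}_{i}^{-}\|$ is maximal over $1\leq i\leq n$, and an index $s\in\{1,\ldots,n\}$ at which $a_{ik}^{-1}$ is maximal over $1\leq i\leq n$, such that $$x_{k}=\alpha\,\|\bm{a}_{k}^{-}\|,\qquad x_{j}\leq\alpha\, a_{sj}^{-1}\quad\text{for all } j\ne k.$$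
   Context: $\mathbb{R}_{\max,+}=\langle\mathbb{R}\cup\{-\infty\},-\infty,0,\max,+\rangle$ is the semifield whose addition $\oplus$ is $\max$, with zero $\mathbb{0}=-\infty$, and whose multiplication $\otimes$ (sign omitted) is ordinary addition, with unit $\mathbb{1}=0$; the multiplicative inverse $x^{-1}$ of $x\in\mathbb{R}$ is $-x$, and the order is the usual one. All scalar, matrix and vector operations in the claim are understood in this semifield. A vector is regular if none of its components is $\mathbb{0}$. ''All columns of $\bm{A}$ are regular'' means that $\bm{A}$ has no entry equal to $\mathbb{0}$. For a regular column vector $\bm{x}=(x_i)$, $\bm{x}^{-}$ is the row vector with components $x_i^{-1}$. For a matrix $\bm{A}=(a_{ij})$ with all columns regular, $\bm{A}^{-}$ is the matrix whose $(i,j)$ entry is $a_{ji}^{-1}$. For a (row or column) vector or a matrix, $\|\cdot\|$ denotes the $\oplus$-sum (i.e. the maximum) of all its entries. *)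

(* Defs.v *)
From HB Require Import structures.
From mathcomp Require Import all_boot all_order all_algebra.
From mathcomp Require Import reals.

Set Implicit Arguments.
Unset Strict Implicit.
Unset Printing Implicit Defensive.

Import Order.TTheory GRing.Theory Num.Theory.
Local Open Scope ring_scope.

(* [None] is -oo. The semiring instance declared below makes [0], [1], [+],
   [*], [\sum] and [*m] on [maxplus R] the max-plus ones: [0] is -oo, [1] is the
   real number 0, [+] is the maximum and [*] is the addition of R. *)
Definition maxplus (R : Type) : Type := option R.

HB.instance Definition _ (R : choiceType) := Choice.copy (maxplus R) (option R).

Section MaxPlus.
Context {R : realDomainType}.
Implicit Types x y z : maxplus R.

Definition mpadd x y : maxplus R :=
  match x, y with
  | Some a, Some b => Some (Num.max a b)
  | None, _ => y
  | _, None => x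
  end.

Definition mpmul x y : maxplus R :=
  match x, y with
  | Some a, Some b => Some (a + b)
  | _, _ => None
  end.

Definition mple x y : bool :=
  match x, y with
  | None, _ => true
  | Some _, None => false
  | Some a, Some b => a <= b
  end.

(* Junk value: [mpinv 0 = 0]. *)
Definition mpinv x : maxplus R := omap -%R x.

Fact mpaddA : associative mpadd.
Proof. by move=> [a|] [b|] [c|] //=; rewrite maxA. Qed.

Fact mpaddC : commutative mpadd.
Proof. by move=> [a|] [b|] //=; rewrite maxC. Qed.

Fact mpadd0 : left_id None mpadd.
Proof. by case. Qed.

HB.instance Definition _ :=
  GRing.isNmodule.Build (maxplus R) mpaddA mpaddC mpadd0.

Fact mpmulA : associative mpmul.
Proof. by move=> [a|] [b|] [c|] //=; rewrite addrA. Qed.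

Fact mpmulC : commutative mpmul.
Proof. by move=> [a|] [b|] //=; rewrite addrC. Qed.

Fact mpmul1 : left_id (Some 0) mpmul.
Proof. by case=> [a|] //=; rewrite add0r. Qed.

Fact mpmulDl : left_distributive mpmul mpadd.
Proof. by move=> [a|] [b|] [c|] //=; rewrite addr_maxl. Qed.

Fact mpmul0 : left_zero None mpmul.
Proof. by []. Qed.

Fact mpone_neq0 : Some 0 != None :> maxplus R.
Proof. by []. Qed.

HB.instance Definition _ :=
  GRing.Nmodule_isComNzSemiRing.Build (maxplus R)
    mpmulA mpmulC mpmul1 mpmulDl mpmul0 mpone_neq0.

Fact mple_anti : antisymmetric mple.
Proof. by move=> [a|] [b|] //= /le_anti ->. Qed.

Fact mple_trans : transitive mple.
Proof. by move=> [b|] [a|] [c|] //=; apply: le_trans. Qed.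

Fact mple_total : total mple.
Proof. by move=> [a|] [b|] //=; apply: le_total. Qed.

HB.instance Definition _ :=
  Order.isOrder.Build ring_display (maxplus R)
    (fun _ _ => erefl) (fun _ _ => erefl) (fun _ _ => erefl)
    mple_anti mple_trans mple_total.

Definition regular m n (A : 'M[maxplus R]_(m, n)) : Prop :=
  forall i j, A i j != 0.

(* The conjugate [A^-], meaningful when [A] is regular. *)
Definition mpconj m n (A : 'M[maxplus R]_(m, n)) : 'M[maxplus R]_(n, m) :=
  \matrix_(i, j) mpinv (A j i).

Definition mpnorm m n (A : 'M[maxplus R]_(m, n)) : maxplus R :=
  \sum_i \sum_j A i j.

End MaxPlus.

(* Main.v *)
Require Import Defs.
From HB Require Import structures.
From mathcomp Require Import all_boot all_order all_algebra.
From mathcomp Require Import reals.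

Set Implicit Arguments.
Unset Strict Implicit.
Unset Printing Implicit Defensive.

Import Order.TTheory GRing.Theory Num.Theory.
Local Open Scope ring_scope.

(* If [y = A x] is extremal with largest entry [y_i = a_ik x_k] and smallest
   entry [y_l], then [y_l >= a_lk x_k] gives
   [y_i y_l^-1 <= a_ik a_lk^-1 <= Delta].  Equality throughout forces
   [y_l = a_lk x_k], so that the parameters are [alpha = y_l], [s = l] and [k].
   Conversely these conditions say that [y_s = alpha], while
   [y_i >= a_ik x_k] for an entry [a_ik] of largest value in column [k]. *)

Section MaxPlusOrder.
Context {R : realDomainType}.
Implicit Types x y z : maxplus R.

Lemma mpleE x y : (x <= y) = mple x y.
Proof. by []. Qed.

Lemma mple0x x : (0 : maxplus R) <= x.
Proof. by []. Qed.

Lemma mplt0x x : ((0 : maxplus R) < x) = (x != 0).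
Proof. by rewrite lt_neqAle mple0x andbT eq_sym. Qed.

Lemma mpaddE x y : x + y = Order.max x y.
Proof.
case: (leP x y); case: x y => [a|] [b|] //=.
- by rewrite mpleE /= => ab; congr Some; apply/max_r.
- by rewrite ltNge mpleE /= -ltNge => ba; congr Some; apply/max_l/ltW.
Qed.

Lemma mpinv_neq0 x : (mpinv x != 0) = (x != 0).
Proof. by case: x. Qed.

Lemma mpmul_neq0 x y : x != 0 -> y != 0 -> x * y != 0.
Proof. by case: x y => [a|] [b|]. Qed.

Lemma mpmulV x : x != 0 -> x * mpinv x = 1.
Proof. by case: x => [a|] // _; congr Some; rewrite subrr. Qed.

Lemma mpmulK x y : y != 0 -> x * y * mpinv y = x.
Proof. by move=> y0; rewrite -mulrA mpmulV // mulr1. Qed.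

Lemma mpmulVK x y : y != 0 -> x * mpinv y * y = x.
Proof. by move=> y0; rewrite mulrAC mpmulK. Qed.

Lemma ler_mpM2r z x y : z != 0 -> (x * z <= y * z) = (x <= y).
Proof. by case: z x y => [c|] [a|] [b|] // _; rewrite !mpleE /= lerD2r. Qed.

Lemma ler_mpM2l z x y : z != 0 -> (z * x <= z * y) = (x <= y).
Proof. by move=> z0; rewrite ![z * _]mulrC ler_mpM2r. Qed.

Lemma ler_mpM x y z t : x <= y -> z <= t -> x * z <= y * t.
Proof.
case: x y z t => [a|] [b|] [c|] [d|] //; rewrite !mpleE /= => ? ?.
exact: lerD.
Qed.

Lemma ler_mpdivlMr z x y : z != 0 -> (x <= y * mpinv z) = (x * z <= y).
Proof. by move=> z0; rewrite -(ler_mpM2r _ _ z0) mpmulVK. Qed.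

Lemma ler_mpdivrMr z x y : z != 0 -> (x * mpinv z <= y) = (x <= y * z).
Proof. by move=> z0; rewrite -(ler_mpM2r _ _ z0) mpmulVK. Qed.

Lemma mpsum_ub (I : finType) (F : I -> maxplus R) i : F i <= \sum_j F j.
Proof. by rewrite (bigD1 i) //= mpaddE le_max lexx. Qed.

Lemma mpsum_lub (I : finType) (F : I -> maxplus R) c :
  (forall i, F i <= c) -> \sum_i F i <= c.
Proof.
move=> Fc; apply: (big_ind (fun x => x <= c)) => // x y xc yc.
by rewrite mpaddE ge_max xc.
Qed.

(** The argument [I] supplies an index: an empty sum is [0], that is -oo, and need not be a value of
    [F]. A finite maximum is either [0] or one of its terms; if it is [0], every term lies below
    [0], so any index attains it. *)
Lemma mpsum_attained (I : finType) (F : I -> maxplus R) :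
  I -> exists i, \sum_j F j = F i.
Proof.
move=> i0; have: \sum_j F j = 0 \/ exists i, \sum_j F j = F i.
  elim/big_ind: _ => [|x y Hx Hy|i _]; [by left| |by right; exists i].
  by rewrite mpaddE; case: leP.
case=> // F0; exists i0; apply/le_anti.
by rewrite mpsum_ub {1}F0 mple0x.
Qed.

Lemma mpnorm_ub m n (M : 'M[maxplus R]_(m, n)) i j : M i j <= mpnorm M.
Proof.
apply: le_trans (mpsum_ub (fun i => \sum_j M i j) i).
exact: (mpsum_ub (M i)).
Qed.

Lemma mpnorm_lub m n (M : 'M[maxplus R]_(m, n)) c :
  (forall i j, M i j <= c) -> mpnorm M <= c.
Proof. by move=> Mc; apply: mpsum_lub => i; apply: mpsum_lub. Qed.

Lemma mpnorm_attained m n (M : 'M[maxplus R]_(m, n)) :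
  'I_m -> 'I_n -> exists i j, mpnorm M = M i j.
Proof.
move=> i0 j0; rewrite /mpnorm.
have [i ->] := mpsum_attained (fun i => \sum_j M i j) i0.
by have [j ->] := mpsum_attained (M i) j0; exists i, j.
Qed.

(** For a regular nonempty vector this is, in ordinary arithmetic, the largest entry minus the
    smallest: the objective of the problem. *)
Definition mpspread n (v : 'cV[maxplus R]_n) := mpnorm v * mpnorm (mpconj v).

Lemma mpspread_ub n (v : 'cV[maxplus R]_n) i l :
  v i 0 * mpinv (v l 0) <= mpspread v.
Proof.
apply: ler_mpM; first exact: mpnorm_ub.
by have := mpnorm_ub (mpconj v) 0 l; rewrite mxE.
Qed.

Lemma mpspread_attained n (v : 'cV[maxplus R]_n) :
  'I_n -> exists i l, mpspread v = v i 0 * mpinv (v l 0).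
Proof.
move=> i0; rewrite /mpspread.
have [i [u ->]] := mpnorm_attained v i0 0.
have [w [l ->]] := mpnorm_attained (mpconj v) 0 i0.
by rewrite mxE (ord1 u) (ord1 w); exists i, l.
Qed.

Lemma mpnorm_conj_col n (A : 'M[maxplus R]_n) k s :
  (forall i, mpinv (A i k) <= mpinv (A s k)) ->
  mpnorm (mpconj (col k A)) = mpinv (A s k).
Proof.
move=> smax; apply/le_anti/andP; split.
  by apply: mpnorm_lub => i j; rewrite !mxE.
by have := mpnorm_ub (mpconj (col k A)) 0 s; rewrite !mxE.
Qed.

Section MulConj.
Variables (n : nat) (A : 'M[maxplus R]_n).
Hypothesis A_neq0 : forall i j, A i j != 0.
Let Delta := mpnorm (A *m mpconj A).

Lemma mulconj_ub i l k : A i k * mpinv (A l k) <= Delta.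
Proof.
apply: le_trans (mpnorm_ub _ i l); rewrite mxE.
by have := mpsum_ub (fun j => A i j * mpconj A j l) k; rewrite mxE.
Qed.

Lemma mulconj_attained : 'I_n -> exists i l k, Delta = A i k * mpinv (A l k).
Proof.
move=> i0; rewrite /Delta.
have [i [l ->]] := mpnorm_attained (A *m mpconj A) i0 i0; rewrite mxE.
have [k ->] := mpsum_attained (fun j => A i j * mpconj A j l) i0.
by rewrite mxE; exists i, l, k.
Qed.

Lemma mpspread_col_le k : mpspread (col k A) <= Delta.
Proof.
have [i [l ->]] := mpspread_attained (col k A) k.
by rewrite !mxE mulconj_ub.
Qed.

Lemma mulmx_ub (x : 'cV[maxplus R]_n) i j : A i j * x j 0 <= (A *m x) i 0.
Proof. by rewrite mxE (mpsum_ub (fun j => A i j * x j 0)). Qed.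

Lemma mulmx_neq0 (x : 'cV[maxplus R]_n) i :
  regular x -> (A *m x) i 0 != 0.
Proof.
move=> x0; rewrite -mplt0x.
(* Any single term of the row bounds y_i from below by a nonzero value; since [A] is square, the
   diagonal one is at hand. *)
by apply: lt_le_trans (mulmx_ub x i i); rewrite mplt0x mpmul_neq0.
Qed.

(** Only the larger entry y_i is expanded, along a column [k] attaining it; y_l stays whole, to be
    compared with its own term a_lk x_k in the same column. *)
Lemma mpspread_mulmx (x : 'cV[maxplus R]_n) : 'I_n -> regular x ->
  exists i l k, [/\ mpspread (A *m x) = (A *m x) i 0 * mpinv ((A *m x) l 0)
                  & (A *m x) i 0 = A i k * x k 0].
Proof.
move=> i0 x0; have [i [l ->]] := mpspread_attained (A *m x) i0.
have [k ik] := mpsum_attained (fun j => A i j * x j 0) i0.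
by exists i, l, k; split; rewrite // mxE.
Qed.

Lemma mpspread_mulmx_le (x : 'cV[maxplus R]_n) : 'I_n -> regular x ->
  mpspread (A *m x) <= Delta.
Proof.
move=> i0 x0; have [i [l [k [-> ->]]]] := mpspread_mulmx i0 x0.
apply: le_trans (mulconj_ub i l k).
(* Cancelling a_ik leaves x_k <= a_lk^-1 y_l, which is y_l >= a_lk x_k. *)
rewrite ler_mpdivrMr ?mulmx_neq0 // -mulrA ler_mpM2l //.
by rewrite mulrC ler_mpdivlMr // mulrC mulmx_ub.
Qed.

(** The conditions of the theorem for fixed parameters; unfolding [mpspread] gives the products of
    norms used there. *)
Definition extremal_param (x : 'cV[maxplus R]_n) alpha (k s : 'I_n) :=
  [/\ (0 : maxplus R) < alpha,
      forall i, mpspread (col i A) <= mpspread (col k A),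
      forall i, mpinv (A i k) <= mpinv (A s k),
      x k 0 = alpha * mpnorm (mpconj (col k A))
    & forall j, j != k -> x j 0 <= alpha * mpinv (A s j)].

Lemma extremal_paramP (x : 'cV[maxplus R]_n) : 'I_n -> regular x ->
  mpspread (A *m x) = Delta -> exists alpha k s, extremal_param x alpha k s.
Proof.
move=> i0 x0; have [i [l [k [-> yi]]]] := mpspread_mulmx i0 x0 => yD.
have y0 := mulmx_neq0 l x0.
(* The reverse of y_l >= a_lk x_k amounts to a_ik a_lk^-1 <= y_i y_l^-1, and the right-hand side is
   [Delta] by extremality. *)
have yl : (A *m x) l 0 = A l k * x k 0.
  apply/le_anti; rewrite mulmx_ub andbT mulrC -ler_mpdivrMr //.
  rewrite -(ler_mpM2l _ _ (A_neq0 i k)) mulrA -yi mulrAC.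
  by rewrite -ler_mpdivlMr // yD mulconj_ub.
have DE : Delta = A i k * mpinv (A l k).
  apply/le_anti; rewrite mulconj_ub andbT -yD ler_mpdivrMr // yl yi.
  by rewrite mulrA mpmulVK.
(* Multiplied by a_ik, this reads a_ik a_pk^-1 <= [Delta], an instance of the bound on the entries
   of A A^-. *)
have lmax p : mpinv (A p k) <= mpinv (A l k).
  by rewrite -(ler_mpM2l _ _ (A_neq0 i k)) -DE mulconj_ub.
exists ((A *m x) l 0), k, l; split=> //.
- by rewrite mplt0x.
(* [Delta] dominates the spread of every column, and it equals a_ik a_lk^-1, which the spread of
   column [k] dominates. *)
- move=> j; apply: (le_trans (mpspread_col_le j)); rewrite DE.
  by have := mpspread_ub (col k A) i l; rewrite !mxE.
- by rewrite (mpnorm_conj_col lmax) yl [A l k * _]mulrC mpmulK.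
- by move=> j _; rewrite ler_mpdivlMr // mulrC mulmx_ub.
Qed.

Lemma extremal_param_attains (x : 'cV[maxplus R]_n) alpha k s :
  regular x -> extremal_param x alpha k s -> mpspread (A *m x) = Delta.
Proof.
move=> x0 [alpha0 kmax smax xk xj].
rewrite (mpnorm_conj_col smax) in xk.
(* Each term a_sj x_j is at most [alpha]: by the inequality on x_j for j != k, and with equality for
   j = k, since the norm of a_k^- is a_sk^-1. *)
have ys : (A *m x) s 0 <= alpha.
  rewrite mxE; apply: mpsum_lub => j; rewrite mulrC -ler_mpdivlMr //.
  by have [->|/xj //] := eqVneq j k; rewrite xk.
apply/le_anti; rewrite mpspread_mulmx_le //=.
(* [Delta] is a ratio of two entries of one column [j], hence at most the spread of that column and
   so at most the spread of column [k]. *)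
have [p [q [j ->]]] := mulconj_attained k.
have := mpspread_ub (col j A) p q; rewrite !mxE => /le_trans; apply.
apply: le_trans (kmax j) _.
(* With a_ik the largest entry of column [k], its spread is a_ik a_sk^-1. This is at most y_i
   y_s^-1, because y_i >= a_ik x_k = a_ik alpha a_sk^-1 and y_s <= alpha. *)
have [i [u ni]] := mpnorm_attained (col k A) k 0.
rewrite /mpspread ni mxE (mpnorm_conj_col smax).
apply: le_trans (mpspread_ub _ i s); rewrite ler_mpdivlMr ?mulmx_neq0 //.
apply: le_trans (mulmx_ub x i k); rewrite xk -mulrA ler_mpM2l //.
by rewrite mulrC ler_mpM2r ?mpinv_neq0.
Qed.

Lemma extremal_param_exists : 'I_n ->
  exists (x : 'cV[maxplus R]_n) k s, regular x /\ extremal_param x 1 k s.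
Proof.
move=> i0.
have [k kE] := mpsum_attained (fun i => mpspread (col i A)) i0.
have [s sE] := mpsum_attained (fun i => mpinv (A i k)) i0.
have smax i : mpinv (A i k) <= mpinv (A s k).
  by rewrite -sE (mpsum_ub (fun i => mpinv (A i k))).
(* The witness is the conjugate of row [s]: with alpha = 1, all the inequalities on x_j become
   equalities. *)
exists (\col_j mpinv (A s j)), k, s; split.
  by move=> i j; rewrite mxE mpinv_neq0.
split=> // [i||j _]; last by rewrite mxE mul1r.
  by rewrite -kE (mpsum_ub (fun i => mpspread (col i A))).
by rewrite (mpnorm_conj_col smax) mxE mul1r.
Qed.

End MulConj.

End MaxPlusOrder.

Theorem lemma5 (R : realType) (n : nat) (hn : (0 < n)%N)
    (A : 'M[maxplus R]_n) (hA : forall j : 'I_n, regular (col j A)) :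
  let Delta := mpnorm (A *m mpconj A) in
  let objective (y : 'cV[maxplus R]_n) := mpnorm y * mpnorm (mpconj y) in
  [/\ exists x y : 'cV[maxplus R]_n,
        [/\ regular x, A *m x = y & objective y = Delta],
      forall x y : 'cV[maxplus R]_n,
        regular x -> A *m x = y -> objective y <= Delta
    & forall x y : 'cV[maxplus R]_n, regular x -> A *m x = y ->
        (objective y = Delta <->
         exists (alpha : maxplus R) (k s : 'I_n),
           [/\ (0 : maxplus R) < alpha,
               forall i : 'I_n,
                 mpnorm (col i A) * mpnorm (mpconj (col i A))
                 <= mpnorm (col k A) * mpnorm (mpconj (col k A)),
               forall i : 'I_n, mpinv (A i k) <= mpinv (A s k),
               x k 0 = alpha * mpnorm (mpconj (col k A))
             & forall j : 'I_n, j != k -> x j 0 <= alpha * mpinv (A s j)])].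
Proof.
have A0 i j : A i j != 0 by have := hA j i 0; rewrite mxE.
have i0 : 'I_n := Ordinal hn.
move=> Delta objective; split.
- have [x [k [s [x0 xP]]]] := extremal_param_exists A0 i0.
  exists x, (A *m x); split=> //.
  exact: extremal_param_attains xP.
- by move=> x _ x0 <-; apply: mpspread_mulmx_le.
- move=> x _ x0 <-; split; first exact: extremal_paramP.
  by move=> [alpha [k [s xP]]]; apply: extremal_param_attains xP.
Qed.
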